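(* Let $\mathcal{A}\subset\mathbb{R}^d$ be a (possibly infinite) set of atoms such that $\mathcal{M}=\operatorname{conv}(\mathcal{A})$ is compact, let $f$ be a convex differentiable function with finite curvature constant $C_f$ over $\mathcal{M}$, let $\boldsymbol{x}^*$ be a minimizer of $f$ over $\mathcal{M}$, and let $\eta\in(0,1]$. Let $(\boldsymbol{x}_t)_{t\ge 0}$ be the iterates of the Randomized Frank-Wolfe algorithm started at $\boldsymbol{x}_0\in\mathcal{M}$ with sampling ratio $\eta$, with step sizes chosen by either Variant 1 or Variant 2. Then the algorithm converges towards a solution of $\min_{\boldsymbol{x}\in\mathcal{M}} f(\boldsymbol{x})$, in the sense that $\mathbb{E}[f(\boldsymbol{x}_T)]\to f(\boldsymbol{x}^* )$ as $T\to\infty$; furthermore, for every $T\ge 0$, $$\mathbb{E}\big[f(\boldsymbol{x}_T)-f(\boldsymbol{x}^* )\big]\;\le\;\frac{2\big(C_f+f(\boldsymbol{x}_0)-f(\boldsymbol{x}^* )\big)}{\eta T+2},$$ where $\mathbb{E}$ is the full expectation over all the randomness until iteration $T$.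
   Context: **Curvature constant.** For $f$ convex and differentiable and $\mathcal{M}$ convex and compact, $$C_f=\sup_{\substack{\boldsymbol{x},\boldsymbol{s}\in\mathcal{M},\ \gamma\in(0,1]\\ \boldsymbol{y}=\boldsymbol{x}+\gamma(\boldsymbol{s}-\boldsymbol{x})}}\frac{2}{\gamma^2}\big(f(\boldsymbol{y})-f(\boldsymbol{x})-\langle\nabla f(\boldsymbol{x}),\boldsymbol{y}-\boldsymbol{x}\rangle\big).$$ **Linear minimization oracle.** For a set $\mathcal{B}$ and a vector $\boldsymbol{r}$, $\mathrm{LMO}(\boldsymbol{r},\mathcal{B})$ denotes an element of $\arg\min_{\boldsymbol{v}\in\mathcal{B}}\langle \boldsymbol{v},\boldsymbol{r}\rangle$. The minimum is assumed attained wherever the oracle is called, and linear functionals are assumed to attain their minimum on $\mathcal{A}$. **Randomized Frank-Wolfe algorithm.** Input: $\boldsymbol{x}_0\in\mathcal{M}$ and $\eta\in(0,1]$. For $t=0,1,2,\dots$: 1. Draw a random (nonempty) subset $\mathcal{A}_t\subseteq\mathcal{A}$, with fresh randomness independent of the past, such that $\mathbb{P}(\boldsymbol{v}\in\mathcal{A}_t)=\eta$ for every $\boldsymbol{v}\in\mathcal{A}$ (so this also holds conditionally on all the randomness before iteration $t$). 2. Set $\boldsymbol{s}_t=\mathrm{LMO}(\nabla f(\boldsymbol{x}_t),\mathcal{A}_t)$. 3. Choose the step size. Variant 1 (exact line search): $\gamma_t\in\arg\min_{\gamma\in[0,1]}f\big((1-\gamma)\boldsymbol{x}_t+\gamma\boldsymbol{s}_t\big)$.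 Variant 2 (which requires $C_f>0$): $\gamma_t=\mathrm{clip}_{[0,1]}\big(\langle-\nabla f(\boldsymbol{x}_t),\boldsymbol{s}_t-\boldsymbol{x}_t\rangle/C_f\big)$, where $\mathrm{clip}_{[0,1]}(u)=\max\{0,\min\{1,u\}\}$. 4. Set $\boldsymbol{x}_{t+1}=(1-\gamma_t)\boldsymbol{x}_t+\gamma_t\boldsymbol{s}_t$. The same variant is used at all iterations. All random quantities are assumed measurable. *)

(* Defs.v *)
From HB Require Import structures.
From mathcomp Require Import all_boot all_order all_algebra.
From mathcomp Require Import all_classical all_reals all_analysis.

Set Implicit Arguments.
Unset Strict Implicit.
Unset Printing Implicit Defensive.

Import Order.TTheory GRing.Theory Num.Theory.
Import numFieldNormedType.Exports.

Local Open Scope classical_set_scope.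
Local Open Scope ring_scope.

Definition dot (R : realType) (d : nat) (u v : 'rV[R]_d) : R :=
  \sum_(i < d) u ord0 i * v ord0 i.

Definition grad (R : realType) (d : nat) (f : 'rV[R]_d -> R) (x : 'rV[R]_d)
    : 'rV[R]_d :=
  \row_(i < d) 'D_(delta_mx ord0 i) f x.

Definition convex_hull (R : realType) (d : nat) (A : set 'rV[R]_d)
    : set 'rV[R]_d :=
  smallest (@convex_set R 'rV[R]_d) A.

(* The supremum is taken in the extended reals, so that its finiteness is an
   explicit hypothesis wherever it is needed. *)
Definition curvature (R : realType) (d : nat) (f : 'rV[R]_d -> R)
    (M : set 'rV[R]_d) : \bar R :=
  ereal_sup [set c : \bar R | exists x s y : 'rV[R]_d, exists gamma : R,
    [/\ M x, M s, 0 < gamma <= 1, y = x + gamma *: (s - x) &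
        c = (2 / gamma ^+ 2 * (f y - f x - dot (grad f x) (y - x)))%:E]].

Definition is_minimizer (R : realType) (T : Type) (g : T -> R) (B : set T)
    (v : T) : Prop :=
  B v /\ forall w, B w -> g v <= g w.

Definition is_LMO (R : realType) (d : nat) (r : 'rV[R]_d)
    (B : set 'rV[R]_d) (v : 'rV[R]_d) : Prop :=
  is_minimizer (fun w => dot w r) B v.

Definition exact_line_search (R : realType) (d : nat) (f : 'rV[R]_d -> R)
    (x s : 'rV[R]_d) (gamma : R) : Prop :=
  is_minimizer (fun g : R => f ((1 - g) *: x + g *: s)) `[0, 1] gamma.

Definition clip01 (R : realType) (u : R) : R := Num.max 0 (Num.min 1 u).

Definition short_step (R : realType) (d : nat) (f : 'rV[R]_d -> R)
    (Cf : R) (x s : 'rV[R]_d) (gamma : R) : Prop :=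
  gamma = clip01 (dot (- grad f x) (s - x) / Cf).

Definition independent_families (R : realType) (disp : measure_display)
    (Omega : measurableType disp) (P : probability Omega R)
    (F G : set (set Omega)) : Prop :=
  forall E H, F E -> G H -> P (E `&` H) = (P E * P H)%E.

(* A random subset of A is regarded as a random element of the power set of A
   with its cylinder sigma-algebra: it is observed through the events
   "v belongs to the subset", v in A. *)
Definition sampling_events (R : realType) (d : nat) (Omega : Type)
    (A : set 'rV[R]_d) (At : Omega -> set 'rV[R]_d) : set (set Omega) :=
  [set E | exists2 v, A v & E = [set w | At w v]].

Definition random_var_events (R : realType) (Omega : Type)
    (X : Omega -> R) : set (set Omega) :=
  preimage_set_system setT X measurable.

Definition random_vec_events (R : realType) (d : nat) (Omega : Type)
    (X : Omega -> 'rV[R]_d) : set (set Omega) :=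
  [set E | exists i : 'I_d, random_var_events (fun w => X w ord0 i) E].

(* The sigma-algebra of the randomness before iteration t. Oracle answers and
   step sizes are recorded besides the sampled sets since ties may be broken
   at random. With x_0 deterministic, the iterates up to x_t are functions of
   these quantities. *)
Definition history (R : realType) (d : nat) (Omega : Type)
    (A : set 'rV[R]_d) (At : nat -> Omega -> set 'rV[R]_d)
    (s : nat -> Omega -> 'rV[R]_d) (gamma : nat -> Omega -> R) (t : nat)
    : set (set Omega) :=
  <<s [set E | exists2 k, (k < t)%N &
        [\/ sampling_events A (At k) E, random_vec_events (s k) E |
            random_var_events (gamma k) E]] >>.

(* A run of the algorithm, the step-size rule being left open. *)
Record randomized_FW (R : realType) (d : nat) (disp : measure_display)
    (Omega : measurableType disp) (P : probability Omega R)
    (A : set 'rV[R]_d) (f : 'rV[R]_d -> R) (x0 : 'rV[R]_d) (eta : R)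
    (At : nat -> Omega -> set 'rV[R]_d) (s : nat -> Omega -> 'rV[R]_d)
    (gamma : nat -> Omega -> R) (x : nat -> Omega -> 'rV[R]_d) : Prop := {
  rfw_init : forall w, x 0%N w = x0 ;
  rfw_subset : forall t w, At t w `<=` A ;
  rfw_nonempty : forall t w, At t w !=set0 ;
  rfw_measurable_sampling :
    forall t v, A v -> measurable [set w | At t w v] ;
  rfw_measurable_oracle :
    forall t (i : 'I_d), measurable_fun setT (fun w => s t w ord0 i) ;
  rfw_measurable_step : forall t, measurable_fun setT (gamma t) ;
  rfw_sampling_ratio :
    forall t v, A v -> P [set w | At t w v] = eta%:E ;
  rfw_fresh :
    forall t, independent_families P <<s sampling_events A (At t) >>
                (history A At s gamma t) ;
  rfw_oracle : forall t w, is_LMO (grad f (x t w)) (At t w) (s t w) ;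
  rfw_update : forall t w,
    x t.+1 w = (1 - gamma t w) *: x t w + gamma t w *: s t w
}.

(* Main.v *)
(* If A_t contains an atom v whose Frank-Wolfe gap at x_t is at least
   h_t - e, where h_t = f(x_t) - f(xstar), then either step rule gives
   h_{t+1} <= (1 - g) h_t + g e + g^2 C_f / 2 for every g in [0, 1], and
   h_{t+1} <= h_t holds in any case. With g = 2 / (eta t + 2) and e -> 0, the
   rate follows by induction once the favourable event is known to have
   conditional probability eta given the history.
   The exact minimizer v_t of the linear functional over A cannot be used to
   define that event: A may be uncountable, A_t is only observed through the
   events v \in A_t for fixed v, and {v_t \in A_t} need not be measurable, nor
   have probability eta. Instead one takes the first e-optimal atom of a
   countable dense subset of A, the e-optimality being certified by difference
   quotients of f along segments of M, so that it is an event of the history. *)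
Require Import Defs.
From HB Require Import structures.
From mathcomp Require Import all_boot all_order all_algebra.
From mathcomp Require Import all_classical all_reals all_analysis.
From mathcomp Require Import measurable_realfun.
From mathcomp Require Import ring lra.

Set Implicit Arguments.
Unset Strict Implicit.
Unset Printing Implicit Defensive.

Import Order.TTheory GRing.Theory Num.Theory.
Import numFieldNormedType.Exports.

Local Open Scope classical_set_scope.
Local Open Scope ring_scope.

(** * Deterministic analysis: gradients, convexity, curvature and a single step *)

Section deterministic.
Context {R : realType} {d : nat}.
Implicit Types (f : 'rV[R]_d -> R) (u v w x y s r : 'rV[R]_d).

Lemma dotC u v : dot u v = dot v u.
Proof. by apply: eq_bigr => i _; rewrite mulrC. Qed.

Lemma dotDr u v w : dot u (v + w) = dot u v + dot u w.
Proof. by rewrite -big_split; apply: eq_bigr => i _; rewrite mxE mulrDr. Qed.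

Lemma dotZr a u v : dot u (a *: v) = a * dot u v.
Proof. by rewrite /dot mulr_sumr; apply: eq_bigr => i _; rewrite mxE mulrCA. Qed.

Lemma dotNr u v : dot u (- v) = - dot u v.
Proof. by rewrite -scaleN1r dotZr mulN1r. Qed.

Lemma dotBr u v w : dot u (v - w) = dot u v - dot u w.
Proof. by rewrite dotDr dotNr. Qed.

Lemma dotNl u v : dot (- u) v = - dot u v.
Proof. by rewrite dotC dotNr dotC. Qed.

Lemma norm_coord_le x i : `|x ord0 i| <= `|x|.
Proof.
rewrite [`|x|]mx_normrE.
exact: (le_bigmax _ (fun ij : 'I_1 * 'I_d => `|x ij.1 ij.2|) (ord0, i)).
Qed.

(** The norm of row vectors is the sup norm, so the dual l1 norm appears on [u]. *)
Lemma norm_dot_le u v : `|dot u v| <= (\sum_(i < d) `|u ord0 i|) * `|v|.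
Proof.
rewrite mulr_suml; apply: le_trans (ler_norm_sum _ _ _) _.
by apply: ler_sum => i _; rewrite normrM ler_wpM2l// norm_coord_le.
Qed.

Lemma derive_dot f x v : differentiable f x -> 'D_v f x = dot (grad f x) v.
Proof.
move=> df; rewrite deriveE// {1}(row_sum_delta v) linear_sum.
apply: eq_bigr => i _; rewrite linearZ mxE /= -deriveE//.
exact: mulrC.
Qed.

(** Along the steps [1 / (n + 1)] a directional derivative is a sequential limit, so that countably
    many difference quotients suffice to approximate it. *)
Lemma cvg_difference_quotient f x v : differentiable f x ->
  (fun n => n.+1%:R * (f (x + n.+1%:R^-1 *: v) - f x)) @ \oo -->
    dot (grad f x) v.
Proof.
move=> df; rewrite -derive_dot//.
have /cvg_ex[l fl] := @diff_derivable _ _ _ _ _ v df.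
rewrite /derive (cvg_lim _ fl)//.
move/cvgr_dnbhsP : fl => /(_ harmonic).
have h : (forall n, @harmonic R n != 0) /\ @harmonic R n @[n --> \oo] --> 0.
  by split; [move=> n; rewrite gt_eqF// harmonic_gt0|exact: cvg_harmonic].
move=> /(_ h); apply: cvg_trans; apply: near_eq_cvg; near=> n => /=.
by rewrite /harmonic /= invrK [_ *: v + x]addrC.
Unshelve. all: by end_near. Qed.

Lemma convex_hull_convex (A : set 'rV[R]_d) : @convex_set R 'rV[R]_d (convex_hull A).
Proof.
move=> x y l /set_mem xA /set_mem yA; apply/mem_set => B [cB AB].
by apply/set_mem/cB; apply/mem_set; [exact: xA|exact: yA].
Qed.

Lemma sub_convex_hull (A : set 'rV[R]_d) : A `<=` convex_hull A.
Proof. exact: sub_gen_smallest. Qed.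

Lemma scale_onemE (V : lmodType R) (a b : V) (t : R) :
  t *: b + unstable.onem t *: a = a + t *: (b - a).
Proof. by rewrite /unstable.onem scalerBl scalerBr scale1r addrCA. Qed.

Lemma convex_segment (M : set 'rV[R]_d) x y (t : R) :
  @convex_set R 'rV[R]_d M -> M x -> M y -> 0 <= t <= 1 ->
  M (x + t *: (y - x)).
Proof.
move=> cM Mx My /andP[t0 t1].
have := cM y x (Itv01 t0 t1) (mem_set My) (mem_set Mx).
rewrite inE /conv /=; congr (M _).
exact: scale_onemE.
Qed.

Lemma convex_function_segment (M : set 'rV[R]_d) f x y (t : R) :
  @convex_function R 'rV[R]_d M f -> M x -> M y -> 0 <= t <= 1 ->
  f (x + t *: (y - x)) <= f x + t * (f y - f x).
Proof.
move=> cf Mx My /andP[t0 t1].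
have := cf (Itv01 t0 t1) _ _ (mem_set My) (mem_set Mx).
rewrite /conv /= => h; apply: le_trans (_ : _ <= _).
  apply: le_trans h; rewrite le_eqVlt; apply/orP; left; apply/eqP; congr f; exact/esym/scale_onemE.
by rewrite -[t * _]/(t *: (f y - f x : R^o)) -scale_onemE.
Qed.

(** By convexity every difference quotient from [x] towards [y] is at most [f y - f x]; the bound
    passes to the limit. *)
Lemma convex_gradient_le (M : set 'rV[R]_d) f x y :
  @convex_function R 'rV[R]_d M f -> M x -> M y -> differentiable f x ->
  dot (grad f x) (y - x) <= f y - f x.
Proof.
move=> cf Mx My df.
have cv := cvg_difference_quotient (v := y - x) df.
rewrite -(cvg_lim _ cv)//; apply: limr_le; first by apply/cvg_ex; eexists; exact: cv.
apply: nearW => n.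
have n01 : 0 <= (n.+1%:R^-1 : R) <= 1.
  by rewrite invr_ge0 ler0n/= invf_le1// ler1n.
have := convex_function_segment cf Mx My n01.
rewrite -lerBlDl => /(ler_wpM2l (ler0n R n.+1)); rewrite mulrA divff ?mul1r//.
Qed.

(** The half-space of the [w] with [dot v r <= dot w r] is convex and contains [A], hence contains
    the hull. *)
Lemma is_LMO_convex_hull (A : set 'rV[R]_d) r v w :
  is_LMO r A v -> convex_hull A w -> dot v r <= dot w r.
Proof.
move=> [Av vmin] /(_ [set w | dot v r <= dot w r]); apply; split => //.
move=> x y l /set_mem /= vx /set_mem /= vy; apply/mem_set => /=.
rewrite /conv /= scale_onemE ![dot _ r]dotC dotDr dotZr dotBr ![dot r _]dotC.
have /andP[l0 l1] : 0 <= l%:num <= 1 by rewrite ge0 le1.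
nra.
Qed.

Lemma curvature_ge0 f (M : set 'rV[R]_d) x : M x -> (0 <= curvature f M)%E.
Proof.
move=> Mx; apply: ereal_sup_ubound; exists x, x, x, 1; split=> //.
- by rewrite ltr01 lexx.
- by rewrite subrr scaler0 addr0.
- by rewrite dotBr !subrr mulr0.
Qed.

Lemma curvature_bound f (M : set 'rV[R]_d) x s (g : R) :
  curvature f M \is a fin_num -> M x -> M s -> 0 <= g <= 1 ->
  f (x + g *: (s - x)) <=
    f x + g * dot (grad f x) (s - x) + g ^+ 2 / 2 * fine (curvature f M).
Proof.
move=> finC Mx Ms /andP[g0 g1].
(* The supremum ranges over positive step sizes only, so the null step is treated apart. *)
have [->|gn0] := eqVneq g 0; first by rewrite scale0r addr0 expr0n/= !mul0r !addr0.
have gp : 0 < g by rewrite lt_neqAle eq_sym gn0.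
have : ((2 / g ^+ 2 * (f (x + g *: (s - x)) - f x -
    dot (grad f x) (g *: (s - x))))%:E <= curvature f M)%E.
  apply: ereal_sup_ubound; exists x, s, (x + g *: (s - x)), g; split=> //.
    by rewrite gp g1.
  by rewrite [x + _]addrC addrK.
rewrite -(fineK finC) lee_fin dotZr => h.
have g2 : 0 < g ^+ 2 / 2 by rewrite divr_gt0// exprn_gt0.
have := ler_wpM2l (ltW g2) h.
rewrite mulrA (_ : g ^+ 2 / 2 * (2 / g ^+ 2) = 1) ?mul1r; last first.
  by rewrite mulrA divfK// divff// expf_neq0.
lra.
Qed.

Lemma step_convex_comb x s (g : R) : (1 - g) *: x + g *: s = x + g *: (s - x).
Proof. by rewrite addrC scale_onemE. Qed.

Lemma clip01_itv (u : R) : 0 <= clip01 u <= 1.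
Proof. by rewrite /clip01 le_max lexx/= ge_max ler01 ge_min lexx. Qed.

(** Up to the factor [C / 2] and an additive constant, the quadratic is the squared distance from
    [g] to [D / C], and [clip01] projects onto the unit interval. *)
Lemma clip01_min_quadratic (C D g : R) : 0 < C -> 0 <= g <= 1 ->
  (clip01 (D / C)) ^+ 2 / 2 * C - clip01 (D / C) * D <= g ^+ 2 / 2 * C - g * D.
Proof.
move=> C0 /andP[g0 g1]; set u := D / C.
have -> : D = u * C by rewrite divfK// gt_eqF.
suff : (clip01 u) ^+ 2 - 2 * clip01 u * u <= g ^+ 2 - 2 * g * u.
  by move=> /(ler_wpM2r (ltW C0)); lra.
rewrite /clip01 maxEle minEle; case: (leP 1 u) => u1; last first.
  case: (leP 0 u) => u0; first by have := sqr_ge0 (g - u); lra.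
  by have := sqr_ge0 g; have := mulr_ge0_le0 g0 (ltW u0); lra.
(* For [1 <= u] the clipped value is 1, and the difference of the two sides factors as this
   product. *)
rewrite ler01; suff : 0 <= (1 - g) * (2 * u - 1 - g) by lra.
by rewrite mulr_ge0//; lra.
Qed.

(** Exact line search minimizes [f] along the segment, the short step minimizes its quadratic upper
    bound; either way the result competes with any [g'], which the analysis may choose freely. *)
Lemma FW_step_descent f (M : set 'rV[R]_d) x s (g g' : R)
    (C := fine (curvature f M)) :
  curvature f M \is a fin_num -> M x -> M s ->
  exact_line_search f x s g \/ (0 < C /\ short_step f C x s g) ->
  0 <= g' <= 1 ->
  f ((1 - g) *: x + g *: s) <=
    f x + g' * dot (grad f x) (s - x) + g' ^+ 2 / 2 * C.
Proof.
move=> finC Mx Ms [[_ gmin]|[C0 gE]] g'01.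
  apply: le_trans (gmin g' _) _; first by rewrite /= in_itv.
  by rewrite step_convex_comb; exact: curvature_bound.
have := clip01_min_quadratic (dot (- grad f x) (s - x)) C0 g'01.
have := curvature_bound finC Mx Ms (clip01_itv (dot (- grad f x) (s - x) / C)).
by rewrite -gE dotNl step_convex_comb -/C; lra.
Qed.

Lemma FW_step_itv f x s (C g : R) :
  exact_line_search f x s g \/ (0 < C /\ short_step f C x s g) -> 0 <= g <= 1.
Proof.
by move=> [[+ _]|[_ ->]]; [rewrite /= in_itv|rewrite clip01_itv].
Qed.

End deterministic.

(** * Rounding to grids: countable dense subsets and measurability of compositions *)

Section grid.
Context {R : realType} {d : nat}.
Implicit Types (v a : 'rV[R]_d) (z : 'rV[int]_d).

(** Half-open cubes of side [1 / (n + 1)] are named by integer vectors, a countable type, which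
    allows both enumeration and countable unions. *)
Definition cell (n : nat) v : 'rV[int]_d :=
  \row_i Num.floor (n.+1%:R * v ord0 i).

Definition corner (n : nat) z : 'rV[R]_d := \row_i ((z ord0 i)%:~R / n.+1%:R).

Lemma cell_corner (n : nat) z : cell n (corner n z) = z.
Proof.
by apply/rowP => i; rewrite !mxE mulrC divfK// intrKfloor.
Qed.

Lemma norm_cell_lt (n : nat) v a : cell n v = cell n a -> `|v - a| <= n.+1%:R^-1.
Proof.
move=> va; rewrite [`|_|]mx_normrE; apply: bigmax_le => [|[j i] _ /=].
  by rewrite invr_ge0 ler0n.
rewrite ord1 !mxE -(ler_pM2l (ltr0Sn R n)) divff//.
rewrite -[X in X * _](ger0_norm (ler0n R n.+1)) -normrM mulrBr.
have := congr1 (fun z => z ord0 i) va; rewrite !mxE => h.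
have := floor_itv (n.+1%:R * v ord0 i); have := floor_itv (n.+1%:R * a ord0 i).
rewrite h intrD => /andP[? ?] /andP[? ?].
by rewrite ler_norml; apply/andP; split; lra.
Qed.

Lemma cvg_corner_cell v : corner n (cell n v) @[n --> \oo] --> v.
Proof.
apply/cvgrPdist_le => e e0; near=> n.
rewrite distrC; apply: le_trans (norm_cell_lt (cell_corner _ _)) _.
apply: ltW. near: n. exact: near_infty_natSinv_lt (PosNum e0).
Unshelve. all: by end_near. Qed.

(** One point of [A] is chosen in each cell that meets [A], for all grids at once; the cell of [a]
    in a fine enough grid then provides a close point. *)
Lemma countable_dense_subset (A : set 'rV[R]_d) : A !=set0 ->
  exists2 v : nat -> 'rV[R]_d, (forall k, A (v k)) &
    forall a e, A a -> 0 < e -> exists k, `|v k - a| < e.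
Proof.
move=> [a0 Aa0].
pose in_cell (nz : nat * 'rV[int]_d) := [set a | A a /\ cell nz.1 a = nz.2].
(* The value [a0] is a default, for cells that miss [A] and for integers that code no cell. *)
exists (fun k => if unpickle k is Some nz then xget a0 (in_cell nz) else a0).
  by move=> k; case: unpickle => // nz; case: xgetP => // y -> [].
move=> a e Aa e0.
have [n] : exists n, n.+1%:R^-1 < e.
  have [N _ /(_ N) h] := near_infty_natSinv_lt (PosNum e0).
  by exists N; exact: (h (leqnn N)).
exists (pickle (n, cell n a)); rewrite pickleK.
case: xgetP => [y _ [_ /norm_cell_lt /le_lt_trans]|/(_ a) []]//.
exact.
Qed.

Lemma measurable_cell dd (T : measurableType dd) (X : T -> 'rV[R]_d) n z :
  (forall i, measurable_fun setT (fun w => X w ord0 i)) ->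
  measurable [set w | cell n (X w) = z].
Proof.
move=> mX.
pose Y i w := n.+1%:R * X w ord0 i.
rewrite (_ : [set w | _] = \bigcap_(i in [set: 'I_d])
    (Y i @^-1` `[(z ord0 i)%:~R, (z ord0 i + 1)%:~R[%classic)).
  apply: fin_bigcap_measurable => [|i _]; first exact: finite_finset.
  rewrite -[X in measurable X]setTI.
  by apply: measurable_funM => //; exact: measurable_cst.
apply/seteqP; split=> w /= => [wz i _|wz].
  by rewrite /= in_itv /= -floor_eq -wz mxE.
by apply/rowP => i; have := wz i I; rewrite /= in_itv /= -floor_eq mxE => /eqP.
Qed.

(* [f] may be non-measurable away from the range of [X]: continuity at the points
   of the range suffices, by rounding [X] to grids. *)
Lemma measurable_fun_continuous_comp dd (T : measurableType dd)
    (X : T -> 'rV[R]_d) (f : 'rV[R]_d -> R) :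
  (forall i, measurable_fun setT (fun w => X w ord0 i)) ->
  (forall w, {for X w, continuous f}) -> measurable_fun setT (f \o X).
Proof.
move=> mX cf.
apply: (@measurable_fun_cvg _ _ _ _ (fun n w => f (corner n (cell n (X w))))).
  move=> n _ B mB; rewrite setTI.
  rewrite (_ : _ @^-1` B = \bigcup_(z : 'rV[int]_d)
      (if f (corner n z) \in B then [set w | cell n (X w) = z] else set0)).
    apply: countable_bigcupT_measurable => // z.
    by case: ifP => // _; exact: measurable_cell.
  apply/seteqP; split=> [w Bw|w [z _]].
    by exists (cell n (X w)) => //; rewrite mem_set.
  by case: ifPn => // /set_mem Bz /= ->.
by move=> w _; apply: continuous_cvg; [exact: cf|exact: cvg_corner_cell].
Qed.

End grid.

(** * Favourable events independent of the past, and integration over them *)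

Section independence.
Context {R : realType} {disp : measure_display} {Omega : measurableType disp}.
Context (P : probability Omega R).
Implicit Types (E h : set Omega) (Z : Omega -> R) (eta : R).

(* With [k w] the least [k] such that [B k w], take for [E] the set of the [w]
   with [S (k w) w]: the index [k w] is [<<s G >>]-measurable and takes countably
   many values. *)
Lemma independent_selection (G : set (set Omega)) (B S : nat -> set Omega) eta :
  G `<=` measurable ->
  (forall k, <<s G >> (B k)) -> \bigcup_k B k = setT ->
  (forall k, measurable (S k)) ->
  (forall k h, <<s G >> h -> P (S k `&` h) = (eta%:E * P h)%E) -> 0 <= eta ->
  exists E, [/\ measurable E, E `<=` \bigcup_k (B k `&` S k) &
    forall h, <<s G >> h -> P (E `&` h) = (eta%:E * P h)%E].
Proof.
move=> Gm GB BT mS indep eta0.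
have sGm h : <<s G >> h -> measurable h.
  by apply: smallest_sub => //; exact: sigma_algebra_measurable.
have GD k : <<s G >> (seqDU B k).
  exact: (@seqDU_measurable _ (g_sigma_algebraType G) B GB).
have GI h1 h2 : <<s G >> h1 -> <<s G >> h2 -> <<s G >> (h1 `&` h2).
  exact: (@measurableI _ (g_sigma_algebraType G)).
exists (\bigcup_k (S k `&` seqDU B k)); split.
- by apply: bigcupT_measurable => k; apply: measurableI => //; exact: sGm.
- move=> w [k _ [Sw Dw]]; exists k => //; split => //.
  exact: (subset_seqDU Dw).
move=> h Gh.
have trivI (F : nat -> set Omega) : (forall k, F k `<=` seqDU B k) ->
    trivIset setT F.
  move=> FD i j _ _ [w [/FD Di /FD Dj]].
  by apply: (@trivIset_seqDU _ B) => //; exists w.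
rewrite setI_bigcupl measure_bigcup//; last 2 first.
- move=> k _; apply: measurableI; last exact: sGm.
  by apply: measurableI => //; exact: sGm.
- by apply: trivI => k w [[]].
have {2}-> : h = \bigcup_k (seqDU B k `&` h).
  by rewrite -setI_bigcupl -seqDU_bigcup_eq BT setTI.
rewrite measure_bigcup//; last 2 first.
- by move=> k _; apply: measurableI; exact: sGm.
- by apply: trivI => k w [].
(* Termwise, [seqDU B k] and [h] both lie in [<<s G >>], so [indep] applies to [S k] and their
   intersection. *)
rewrite -nneseriesZl//; apply: eq_eseriesr => k _.
by rewrite -setIA; apply: indep; exact: GI.
Qed.

(* Off [E] the function [ZE] below takes a negative value, so that [E] is the
   preimage of [`[0, +oo[] and the integral over [E] is one over the image
   measure. *)
Lemma integral_independent (Z : Omega -> R) E eta :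
  measurable E -> measurable_fun setT Z -> (forall w, 0 <= Z w) -> 0 <= eta ->
  (forall B, measurable B -> P (E `&` Z @^-1` B) = (eta%:E * P (Z @^-1` B))%E) ->
  (\int[P]_(w in E) (Z w)%:E = eta%:E * \int[P]_w (Z w)%:E)%E.
Proof.
move=> mE mZ Z0 eta0 indep.
pose k := NngNum eta0.
pose D : set R := `[0, +oo[%classic.
pose ZE w := if w \in E then Z w else -1.
have mD : measurable D by exact: measurable_itv.
have mZE : measurable_fun setT ZE.
  apply: measurable_fun_ifT => //.
  apply: (measurable_fun_bool true); rewrite setTI.
  by rewrite (_ : _ @^-1` _ = E)//; apply/seteqP; split=> w /=; [move=> /set_mem|move=> /mem_set].
have eqZ : Z @^-1` D = setT.
  by apply/seteqP; split=> // w _; rewrite /D /= in_itv /= Z0.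
have eqE : ZE @^-1` D = E.
  apply/seteqP; split=> w; rewrite /D/ZE /= in_itv /= andbT.
    by case: ifPn => [/set_mem//|_]; rewrite lerNr oppr0 ler10.
  by move=> /mem_set ->.
transitivity (\int[pushforward P ZE]_(y in D) y%:E)%E.
  rewrite ge0_integral_pushforward// ?eqE; last first.
    by move=> y; rewrite inE /D /= in_itv /= andbT lee_fin.
  by apply: eq_integral => w wE /=; rewrite /ZE wE.
transitivity (\int[pushforward (mscale k P) Z]_(y in D) y%:E)%E; last first.
  rewrite ge0_integral_pushforward// ?eqZ//; last first.
    by move=> y; rewrite inE /D /= in_itv /= andbT lee_fin.
  rewrite ge0_integral_mscale//; first exact/measurable_EFinP.
  by move=> w _; rewrite lee_fin.
(* For [B] inside [D], the preimage under [ZE] is the part of the preimage under [Z] lying in [E];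
   independence thus identifies the two image measures on [D]. *)
apply: eq_measure_integral => B mB BD.
rewrite /mscale /= /pushforward; apply: etrans (indep _ mB); congr (P _).
apply/seteqP; split=> w /=; rewrite /ZE.
  case: ifPn => [/set_mem//|_ /BD]; rewrite /D /= in_itv /= andbT.
  by rewrite lerNr oppr0 ler10.
by move=> [/mem_set ->].
Qed.

(** This replaces a conditional expectation. By independence [E] carries the fraction [eta] of the
    integral of [Z]; the factor is [1 - g] there and 1 elsewhere, and
    [eta * (1 - g) + (1 - eta) = 1 - eta * g]. *)
Lemma integral_contraction (Z Z' : Omega -> R) E (eta g b c : R) :
  measurable E -> measurable_fun setT Z -> measurable_fun setT Z' ->
  (forall w, 0 <= Z w <= c) -> (forall w, 0 <= Z' w <= Z w) ->
  (forall w, E w -> Z' w <= (1 - g) * Z w + b) ->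
  0 <= eta <= 1 -> 0 <= g <= 1 -> 0 <= b ->
  (forall B, measurable B -> P (E `&` Z @^-1` B) = (eta%:E * P (Z @^-1` B))%E) ->
  (\int[P]_w (Z' w)%:E <=
    (1 - eta * g)%:E * \int[P]_w (Z w)%:E + (eta * b)%:E)%E.
Proof.
move=> mE mZ mZ' Zc Z'Z Z'E /andP[eta0 eta1] /andP[g0 g1] b0 indep.
have Z0 w : 0 <= Z w by have /andP[] := Zc w.
have Z'0 w : 0 <= Z' w by have /andP[] := Z'Z w.
have mEZ D : measurable_fun D (EFin \o Z).
  by apply: measurable_funTS; exact/measurable_EFinP.
have mEZ' D : measurable_fun D (EFin \o Z').
  by apply: measurable_funTS; exact/measurable_EFinP.
have mEg D : measurable_fun D (fun w => ((1 - g) * Z w)%:E).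
  apply/measurable_EFinP/measurable_funTS.
  by apply: (@measurable_funM _ _ _ _ (cst (1 - g))).
have mEgb D : measurable_fun D (fun w => ((1 - g) * Z w + b)%:E).
  by apply/measurable_EFinP; apply: measurable_funD => //; exact/measurable_EFinP/mEg.
have mC : measurable (~` E) by exact: measurableC.
have split (Y : Omega -> R) : measurable_fun setT Y -> (forall w, 0 <= Y w) ->
  (\int[P]_w (Y w)%:E = \int[P]_(w in E) (Y w)%:E + \int[P]_(w in ~` E) (Y w)%:E)%E.
  move=> mY Y0; rewrite -ge0_integral_setU ?setUv//.
  - exact/measurable_EFinP.
  - by move=> w _; rewrite lee_fin.
  - by rewrite disj_set2E setICr.
have intZ := integral_independent mE mZ Z0 eta0 indep.
have PE : P E = eta%:E.
  have := indep setT measurableT.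
  by rewrite preimage_setT setIT => ->; rewrite -[RHS]mule1 -(probability_setT P).
(* Finiteness, due to the bound [c], lets the integral over the complement of [E] be found by
   subtraction. *)
have finZ : (\int[P]_w (Z w)%:E \is a fin_num)%E.
  rewrite ge0_fin_numE; last by apply: integral_ge0 => w _; rewrite lee_fin.
  apply: (@le_lt_trans _ _ (\int[P]_w c%:E)%E).
    apply: ge0_le_integral => //.
      by move=> w _; rewrite lee_fin (le_trans (Z0 w))//; have /andP[] := Zc w.
    by move=> w _; rewrite lee_fin; have /andP[] := Zc w.
  rewrite integral_cst// [X in (_ * X)%E](_ : _ = 1%E) ?mule1 ?ltry//.
  exact: probability_setT.
rewrite (split _ mZ' Z'0).
have le1 : (\int[P]_(w in E) (Z' w)%:E <=
    (1 - g)%:E * (eta%:E * \int[P]_w (Z w)%:E) + b%:E * eta%:E)%E.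
  have -> : ((1 - g)%:E * (eta%:E * \int[P]_w (Z w)%:E) + b%:E * eta%:E =
      \int[P]_(w in E) ((1 - g) * Z w + b)%:E)%E.
    under [RHS]eq_integral do rewrite EFinD.
    rewrite ge0_integralD//.
    - under [in RHS]eq_integral do rewrite EFinM.
      rewrite ge0_integralZl// ?intZ ?integral_cst//; last by rewrite lee_fin subr_ge0.
      + by rewrite -PE.
      + by move=> w _; rewrite lee_fin.
    - by move=> w _; rewrite lee_fin mulr_ge0// subr_ge0.
  apply: ge0_le_integral => //.
  - by move=> w _; rewrite lee_fin.
have le2 : (\int[P]_(w in ~` E) (Z' w)%:E <= \int[P]_(w in ~` E) (Z w)%:E)%E.
  apply: ge0_le_integral => //.
  - by move=> w _; rewrite lee_fin.
  - by move=> w _; rewrite lee_fin; have /andP[] := Z'Z w.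
apply: le_trans (leeD le1 le2) _.
have := split _ mZ Z0; rewrite intZ.
move: (integral P (~` E) _) => r.
rewrite -(fineK finZ) => eqr.
have -> : r = ((1 - eta) * fine (\int[P]_w (Z w)%:E))%:E.
  move: eqr; case: r => //= r; rewrite -!EFinM -EFinD => -[] /= ?; congr _%:E; lra.
by rewrite -!EFinM -!EFinD lee_fin; lra.
Qed.

End independence.

(** * Runs of the algorithm: pathwise descent, history and favourable events *)

Section randomized_Frank_Wolfe.
Context {R : realType} {d : nat} {A : set 'rV[R]_d} {f : 'rV[R]_d -> R}
  {x0 xstar : 'rV[R]_d} {eta : R} {disp : measure_display}
  {Omega : measurableType disp} {P : probability Omega R}
  {At : nat -> Omega -> set 'rV[R]_d} {s : nat -> Omega -> 'rV[R]_d}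
  {gamma : nat -> Omega -> R} {x : nat -> Omega -> 'rV[R]_d}.
Let M := convex_hull A.
Let C := fine (curvature f M).
Context
  (oracleA : forall r : 'rV[R]_d, exists v, is_LMO r A v)
  (cvxf : @convex_function R 'rV[R]_d M f)
  (difff : forall y, M y -> differentiable f y)
  (finC : curvature f M \is a fin_num)
  (xstar_min : is_minimizer f M xstar)
  (eta01 : 0 < eta <= 1)
  (Mx0 : M x0)
  (run : randomized_FW P A f x0 eta At s gamma x)
  (steps :
  forall t w, exact_line_search f (x t w) (s t w) (gamma t w) \/
    (0 < C /\ short_step f C (x t w) (s t w) (gamma t w))).

(** This is the suboptimality [h_t], as opposed to the Frank-Wolfe gap. *)
Let gap t w := f (x t w) - f xstar.

Lemma oracle_mem t w : M (s t w).
Proof.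
have [Ats _] := rfw_oracle run t w.
exact: sub_convex_hull (rfw_subset run Ats).
Qed.

Lemma iterate_mem t w : M (x t w).
Proof.
elim: t => [|t IH]; first by rewrite (rfw_init run).
rewrite (rfw_update run) step_convex_comb; apply: convex_segment => //.
- exact: convex_hull_convex.
- exact: oracle_mem.
- exact: FW_step_itv (steps t w).
Qed.

Lemma descent t w g : 0 <= g <= 1 ->
  f (x t.+1 w) <= f (x t w) +
    g * dot (grad f (x t w)) (s t w - x t w) + g ^+ 2 / 2 * C.
Proof.
move=> g01; rewrite (rfw_update run).
by apply: FW_step_descent => //; [exact: iterate_mem|exact: oracle_mem].
Qed.

Lemma gap_ge0 t w : 0 <= gap t w.
Proof. by rewrite subr_ge0; apply: xstar_min.2; exact: iterate_mem. Qed.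

(** Both step rules compete with the null step [g = 0]. *)
Lemma gapS_le t w : gap t.+1 w <= gap t w.
Proof.
rewrite lerD2r; apply: le_trans (descent t w (g := 0) _) _.
  by rewrite lexx ler01.
by rewrite !mul0r expr0n /= !mul0r !addr0.
Qed.

(** The bound is deterministic, whence integrability of all the gaps. *)
Lemma gap_le t w : gap t w <= f x0 - f xstar.
Proof.
elim: t => [|t]; first by rewrite /gap (rfw_init run).
exact/le_trans/gapS_le.
Qed.

(* With this generating set, [history A At s gamma t] is convertible to
   [<<s history_generators t >>]. *)
Definition history_generators t : set (set Omega) :=
  [set E | exists2 k, (k < t)%N &
    [\/ sampling_events A (At k) E, random_vec_events (s k) E |
        random_var_events (gamma k) E]].

(** The sample space is retyped with the history as its sigma-algebra, so that being known before
    iteration [t] becomes ordinary measurability. *)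
Let Omega_ t := g_sigma_algebraType (history_generators t).

Lemma history_measurable_oracle t k i : (k < t)%N ->
  measurable_fun (setT : set (Omega_ t)) (fun w : Omega_ t => s k w ord0 i).
Proof.
move=> kt _ B mB; apply: sub_sigma_algebra; exists k => //.
by constructor 2; exists i, B.
Qed.

Lemma history_measurable_step t k : (k < t)%N ->
  measurable_fun (setT : set (Omega_ t)) (gamma k : Omega_ t -> R).
Proof.
move=> kt _ B mB; apply: sub_sigma_algebra; exists k => //.
by constructor 3; exists B.
Qed.

(** The iterate [x k] involves oracle answers and steps of index below [k] only, so [k = t] is
    allowed here. *)
Lemma history_measurable_iterate t k i : (k <= t)%N ->
  measurable_fun (setT : set (Omega_ t)) (fun w : Omega_ t => x k w ord0 i).
Proof.
elim: k i => [|k IH] i kt.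
  rewrite (_ : (fun _ => _) = cst (x0 ord0 i)); first exact: measurable_cst.
  by apply/funext => w; rewrite (rfw_init run).
rewrite (_ : (fun _ => _) = (fun w => (1 - gamma k w) * x k w ord0 i +
    gamma k w * s k w ord0 i)); last first.
  by apply/funext => w; rewrite (rfw_update run) !mxE.
have mg := history_measurable_step kt.
apply: measurable_funD; apply: measurable_funM => //.
- by apply: measurable_funB => //; exact: measurable_cst.
- exact: IH (ltnW kt).
- exact: history_measurable_oracle.
Qed.

Lemma history_generators_measurable t : history_generators t `<=` measurable.
Proof.
move=> E [k _ [[v Av ->]|[i [B mB <-]]|[B mB <-]]].
- exact: (rfw_measurable_sampling run).
- exact: (rfw_measurable_oracle run).
- exact: (rfw_measurable_step run).
Qed.

Lemma history_measurable t E : <<s history_generators t >> E -> measurable E.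
Proof.
apply: smallest_sub; first exact: sigma_algebra_measurable.
exact: history_generators_measurable.
Qed.

(** Differentiability of [f] is known on [M] only; by convexity the moving point stays in [M], which
    is all that rounding to grids requires. *)
Lemma history_measurable_toward t (v : 'rV[R]_d) (a : R) : A v -> 0 <= a <= 1 ->
  measurable_fun (setT : set (Omega_ t))
    (fun w : Omega_ t => f (x t w + a *: (v - x t w))).
Proof.
move=> Av a01.
apply: (measurable_fun_continuous_comp
  (X := fun w : Omega_ t => x t w + a *: (v - x t w))).
  move=> i; rewrite (_ : (fun _ => _) = (fun w : Omega_ t =>
    x t w ord0 i + a * (v ord0 i - x t w ord0 i))); last first.
    by apply/funext => w; rewrite !mxE.
  have mx := history_measurable_iterate i (leqnn t).
  apply: measurable_funD => //; apply: measurable_funM => //.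
  by apply: measurable_funB => //; exact: measurable_cst.
move=> w; apply/differentiable_continuous/difff.
apply: convex_segment => //; [exact: convex_hull_convex|exact: iterate_mem|].
exact: sub_convex_hull.
Qed.

Lemma history_measurable_value t :
  measurable_fun (setT : set (Omega_ t)) (fun w : Omega_ t => f (x t w)).
Proof.
(* Any atom serves: with [a = 0] the point of the segment is the iterate itself. *)
have [v [Av _]] := oracleA 0.
have := @history_measurable_toward t v 0 Av.
under eq_fun do rewrite scale0r addr0.
by apply; rewrite lexx ler01.
Qed.

Lemma history_measurable_gap t :
  measurable_fun (setT : set (Omega_ t)) (gap t : Omega_ t -> R).
Proof.
apply: measurable_funB; first exact: history_measurable_value.
exact: measurable_cst.
Qed.

Lemma measurable_gap t : measurable_fun setT (gap t).
Proof.
by move=> _ B mB; apply: history_measurable (history_measurable_gap _ mB).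
Qed.

Lemma fresh_atom t v h : A v -> <<s history_generators t >> h ->
  P ([set w | At t w v] `&` h) = (eta%:E * P h)%E.
Proof.
move=> Av Gh; rewrite -(rfw_sampling_ratio run t Av).
by apply: (rfw_fresh run (t := t) _ Gh); apply: sub_sigma_algebra; exists v.
Qed.

(* [quotient_event t v n e] certifies, from values of [f] only, that the atom [v]
   has Frank-Wolfe gap at least [gap t w - e] at the iterate [x t w]. *)
Let quotient_event (t : nat) (v : 'rV[R]_d) (n : nat) (e : R) := [set w : Omega |
  n.+1%:R * (f (x t w + n.+1%:R^-1 *: (v - x t w)) - f (x t w)) <= e - gap t w].

Lemma inv_itv (n : nat) : 0 <= (n.+1%:R^-1 : R) <= 1.
Proof. by rewrite invr_ge0 ler0n/= invf_le1// ler1n. Qed.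

Lemma quotient_event_history t v n e : A v ->
  <<s history_generators t >> (quotient_event t v n e).
Proof.
move=> Av; have mf := @history_measurable_value t.
have mv := @history_measurable_toward t v _ Av (inv_itv n).
have : measurable_fun (setT : set (Omega_ t)) (fun w : Omega_ t =>
    n.+1%:R * (f (x t w + n.+1%:R^-1 *: (v - x t w)) - f (x t w)) <= e - gap t w).
  apply: measurable_fun_ler.
    by apply: measurable_funM; [exact: measurable_cst|exact: measurable_funB].
  apply: measurable_funB; first exact: measurable_cst.
  exact: history_measurable_gap.
move=> /(_ measurableT [set true]); rewrite setTI; exact.
Qed.

(** For convex [f] a difference quotient dominates the directional derivative, so the certificate is
    sound for every [n]. *)
Lemma quotient_eventP t v n e w : A v -> quotient_event t v n e w ->
  dot (grad f (x t w)) (v - x t w) <= e - gap t w.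
Proof.
move=> Av; apply: le_trans.
have Mx := iterate_mem t w.
have My : M (x t w + n.+1%:R^-1 *: (v - x t w)).
  apply: convex_segment => //; [exact: convex_hull_convex| |exact: inv_itv].
  exact: sub_convex_hull.
have := convex_gradient_le cvxf Mx My (difff Mx).
rewrite [_ + n.+1%:R^-1 *: _]addrC addrK dotZr.
by rewrite ler_pdivrMl// ltr0n.
Qed.

(** A linear minimizer over [A] does at least as well as [xstar], hence has Frank-Wolfe gap at least
    [gap t w]. A nearby [v k] loses less than [e], and the strict inequality survives in the
    difference quotients for large [n]. *)
Lemma quotient_event_cover t (v : nat -> 'rV[R]_d) e w : 0 < e ->
  (forall k, A (v k)) ->
  (forall a e, A a -> 0 < e -> exists k, `|v k - a| < e) ->
  exists k n, quotient_event t (v k) n e w.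
Proof.
move=> e0 Av dense_v; set r := grad f (x t w).
have Mx := iterate_mem t w.
have [a aLMO] := oracleA r; have Aa := aLMO.1.
have ax : dot r (a - x t w) <= - gap t w.
  have := is_LMO_convex_hull aLMO xstar_min.1.
  have := convex_gradient_le cvxf Mx xstar_min.1 (difff Mx).
  by rewrite -/r !dotBr /gap ![dot _ r]dotC; lra.
pose c := \sum_(i < d) `|r ord0 i|.
have c0 : 0 <= c by apply: sumr_ge0.
(* The added 1 covers a vanishing gradient, where [c = 0]. *)
have [|k vk] := dense_v a (e / (c + 1)) Aa; first by rewrite divr_gt0// ltr_wpDl.
have vkx : dot r (v k - x t w) < e - gap t w.
  have := norm_dot_le r (v k - a).
  have : c * `|v k - a| < e.
    apply: (@le_lt_trans _ _ ((c + 1) * `|v k - a|)).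
      by rewrite ler_wpM2r// lerDl.
    by rewrite mulrC -ltr_pdivlMr// ltr_wpDl.
  rewrite -/c => h1 h2; have := le_lt_trans (le_trans (ler_norm _) h2) h1.
  by move: ax; rewrite !dotBr; lra.
have /cvgr_lt/(_ _ vkx) := cvg_difference_quotient (v := v k - x t w) (difff Mx).
by move=> [N _ /(_ N (leqnn N)) /ltW hN]; exists k, N.
Qed.

(** Freshness concerns fixed atoms; selecting the first certified pair carries it over to an atom
    depending on the past. *)
Lemma good_event t e : 0 < e -> exists E, [/\ measurable E,
  (forall w, E w -> dot (grad f (x t w)) (s t w - x t w) <= e - gap t w) &
  forall h, <<s history_generators t >> h -> P (E `&` h) = (eta%:E * P h)%E].
Proof.
move=> e0.
have [a0 [Aa0 _]] := oracleA 0.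
have [|v Av dense_v] := @countable_dense_subset _ _ A; first by exists a0.
(* Integers code pairs of an atom index and a quotient index. The default pair is harmless, since
   [B j] and [S j] use the same one. *)
pose kn j := odflt (0%N, 0%N) (unpickle j : option (nat * nat)).
pose B j := quotient_event t (v (kn j).1) (kn j).2 e.
pose S j := [set w | At t w (v (kn j).1)].
have [| | | | | |E [mE EBS indE]] := @independent_selection _ _ _ P
    (history_generators t) B S eta.
- exact: history_generators_measurable.
- by move=> j; exact: quotient_event_history.
- apply/seteqP; split=> // w _.
  have [k [n wkn]] := quotient_event_cover t w e0 Av dense_v.
  by exists (pickle (k, n)) => //; rewrite /B /kn pickleK.
- by move=> j; exact: (rfw_measurable_sampling run).
- by move=> j h; exact: fresh_atom.
- by case/andP: eta01 => /ltW.
exists E; split => // w /EBS[j _ [Bw Sw]].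
(* The certified atom has been sampled, so the oracle answer does at least as well. *)
have := quotient_eventP (Av _) Bw.
have := (rfw_oracle run t w).2 _ Sw.
by rewrite !dotBr ![dot _ (grad f _)]dotC; lra.
Qed.

(** * Recursion on the expected gap, rate and convergence *)

Lemma C_ge0 : 0 <= C.
Proof. by rewrite -lee_fin (fineK finC) (curvature_ge0 _ Mx0). Qed.

Lemma integral_gap_step t g e : 0 <= g <= 1 -> 0 < e ->
  (\int[P]_w (gap t.+1 w)%:E <= (1 - eta * g)%:E * \int[P]_w (gap t w)%:E +
    (eta * (g * e + g ^+ 2 / 2 * C))%:E)%E.
Proof.
move=> g01 e0; have [E [mE Egap indE]] := good_event t e0.
have /andP[g0 g1] := g01.
apply: (integral_contraction (c := f x0 - f xstar) mE) => //.
- exact: measurable_gap.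
- exact: measurable_gap.
- by move=> w; rewrite gap_ge0 gap_le.
- by move=> w; rewrite gap_ge0 gapS_le.
- move=> w /Egap /(ler_wpM2l g0); have := descent t w g01.
  rewrite /gap; lra.
- by case/andP: eta01 => /ltW -> ->.
- by rewrite addr_ge0// mulr_ge0 ?C_ge0// ?(ltW e0)// divr_ge0// exprn_ge0.
(* Events defined by [gap t] belong to the history, hence are independent of [E]. *)
- move=> B mB; apply: indE.
  by rewrite -[X in <<s _ >> X]setTI; exact: history_measurable_gap.
Qed.

Lemma integrable_gap t : P.-integrable setT (EFin \o gap t).
Proof.
apply: (@le_integrable _ _ _ _ _ _ _ (cst (f x0 - f xstar)%:E)) => //.
- exact/measurable_EFinP/measurable_gap.
- move=> w _ /=; rewrite lee_fin !ger0_norm ?gap_le ?gap_ge0//.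
  by rewrite subr_ge0; exact: xstar_min.2.
- exact: finite_measure_integrable_cst.
Qed.

Let agap t := fine (\int[P]_w (gap t w)%:E).

Lemma agapE t : (\int[P]_w (gap t w)%:E = (agap t)%:E)%E.
Proof. by rewrite fineK// integrable_fin_num//; exact: integrable_gap. Qed.

Lemma agap_ge0 t : 0 <= agap t.
Proof. by apply: fine_ge0; apply: integral_ge0 => w _; rewrite lee_fin gap_ge0. Qed.

(** The favourable event depends on [e], but no longer appears once integrated, so [e] may tend to
    0. *)
Lemma agap_step t g : 0 <= g <= 1 ->
  agap t.+1 <= (1 - eta * g) * agap t + eta * (g ^+ 2 / 2 * C).
Proof.
move=> g01; apply/ler_addgt0Pr => e e0.
have := integral_gap_step t g01 e0; rewrite !agapE -EFinM -EFinD lee_fin.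
have /andP[g0 g1] := g01; have /andP[eta0 eta1] := eta01.
have : eta * g * e <= e by rewrite ler_piMl ?(ltW e0)// mulr_ile1// ltW.
lra.
Qed.

Lemma agap_le t : agap t <= 2 * (C + f x0 - f xstar) / (eta * t%:R + 2).
Proof.
have /andP[eta0 eta1] := eta01; have C0 := C_ge0.
have h0 : 0 <= f x0 - f xstar by rewrite subr_ge0; exact: xstar_min.2.
elim: t => [|t IH].
  (* At [t = 0] the bound is [C] plus the initial gap, and [0 <= C]. *)
  rewrite mulr0 add0r mulrAC divff// mul1r -lee_fin -agapE.
  under eq_integral do rewrite /gap (rfw_init run).
  rewrite integral_cst// [X in (_ * X)%E](_ : _ = 1%E) ?mule1.
    by rewrite lee_fin; lra.
  exact: probability_setT.
set D := eta * t%:R + 2 in IH; set K := C + f x0 - f xstar in IH *.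
have D2 : 2 <= D by rewrite lerDr mulr_ge0// ltW.
have D0 : 0 < D by lra.
have -> : eta * t.+1%:R + 2 = D + eta by rewrite /D -natr1; lra.
have K0 : 0 <= K by rewrite /K; lra.
have CK : C <= K by rewrite /K; lra.
(* The recursion is applied with [g = 2 / (eta * t + 2)]. *)
have g01 : 0 <= 2 / D <= 1.
  by apply/andP; split; [apply: divr_ge0 => //; exact: ltW|rewrite ler_pdivrMr// mul1r].
apply: le_trans (agap_step t g01) _.
set u := D^-1 in g01 IH *; have Du : D * u = 1 by rewrite divff// gt_eqF.
have u0 : 0 <= u by rewrite invr_ge0 ltW.
have /andP[gu0 gu1] := g01.
have eg : 0 <= 1 - eta * (2 * u) by rewrite subr_ge0 mulr_ile1// ltW.
have h1 := ler_wpM2l eg IH.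
have h2 : eta * ((2 * u) ^+ 2 / 2 * C) <= eta * ((2 * u) ^+ 2 / 2 * K).
  by rewrite ler_wpM2l ?(ltW eta0)// ler_wpM2l// divr_ge0// exprn_ge0.
(* Once [C] is replaced by [K], the terms in [eta * K * u ^+ 2] have coefficients -4 and 2. Then
   [(u - eta * u ^+ 2) * (D + eta)] equals [1 - (eta * u) ^+ 2], at most 1. *)
apply: (@le_trans _ _ (2 * K * (u - eta * u ^+ 2))); first lra.
rewrite ler_pdivlMr; last by lra.
have -> : 2 * K * (u - eta * u ^+ 2) * (D + eta) =
    2 * K * (D * u + eta * u - eta * u * (D * u) - (eta * u) ^+ 2) by ring.
by rewrite Du mulr1 addrK ler_piMr ?mulr_ge0// gerBl sqr_ge0.
Qed.

Lemma expectation_gap t : ('E_P[gap t] = (agap t)%:E)%E.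
Proof. by rewrite unlock agapE. Qed.

Lemma expectation_value t :
  ('E_P[fun w => f (x t w)] = (agap t + f xstar)%:E)%E.
Proof.
rewrite unlock EFinD -agapE -[X in (_ + X)%E]mule1 -(probability_setT P).
rewrite -integral_cst// -integralD//.
- by apply: eq_integral => w _; rewrite -EFinD subrK.
- exact: integrable_gap.
- exact: finite_measure_integrable_cst.
Qed.

Lemma cvg_expectation_value :
  ('E_P[fun w => f (x t w)])%E @[t --> \oo] --> (f xstar)%:E.
Proof.
under eq_fun do rewrite expectation_value.
apply/cvg_EFin; first exact: nearW.
rewrite -[X in _ --> X]add0r; apply: cvgD; last exact: cvg_cst.
have /andP[eta0 _] := eta01.
set K := 2 * (C + f x0 - f xstar).
(* As [eta <= 2], the denominator [eta * t + 2] is at least [eta * (t + 1)], which gives a harmonic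
   majorant. *)
apply: (@squeeze_cvgr _ _ _ _ (cst 0) (fun t => K / eta * t.+1%:R^-1)).
- apply: nearW => t; rewrite agap_ge0; apply: le_trans (agap_le t) _.
  rewrite -/K -mulrA -invfM ler_wpM2l//.
    have := C_ge0; have : f xstar <= f x0 by exact: xstar_min.2.
    by rewrite /K; lra.
  rewrite lef_pV2 ?posrE ?mulr_gt0 ?ltr_wpDl ?mulr_ge0 ?(ltW eta0)//.
  rewrite -natr1; have := eta01; lra.
- exact: cvg_cst.
- rewrite -[X in _ --> X](mulr0 (K / eta)); apply: cvgM; first exact: cvg_cst.
  exact: cvg_harmonic.
Qed.

End randomized_Frank_Wolfe.

Theorem theorem2p1 (R : realType) (d : nat)
    (A : set 'rV[R]_d) (f : 'rV[R]_d -> R) (x0 xstar : 'rV[R]_d) (eta : R)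
    (disp : measure_display) (Omega : measurableType disp)
    (P : probability Omega R)
    (At : nat -> Omega -> set 'rV[R]_d) (s : nat -> Omega -> 'rV[R]_d)
    (gamma : nat -> Omega -> R) (x : nat -> Omega -> 'rV[R]_d) :
  let M := convex_hull A in
  let Cf := fine (curvature f M) in
  compact M ->
  (forall r : 'rV[R]_d, exists v, is_LMO r A v) ->
  convex_function M f ->
  (forall y, M y -> differentiable f y) ->
  curvature f M \is a fin_num ->
  is_minimizer f M xstar ->
  0 < eta <= 1 ->
  M x0 ->
  randomized_FW P A f x0 eta At s gamma x ->
  (forall t w, exact_line_search f (x t w) (s t w) (gamma t w)) \/
  (0 < Cf /\
   forall t w, short_step f Cf (x t w) (s t w) (gamma t w)) ->
  (('E_P[fun w => f (x T w)])%E @[T --> \oo] --> (f xstar)%:E) /\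
  (forall T : nat,
    ('E_P[fun w => (f (x T w) - f xstar)%R] <=
     (2 * (Cf + f x0 - f xstar) / (eta * T%:R + 2))%:E)%E).
Proof.
move=> M Cf _ oracleA cvxf difff finC xmin eta01 Mx0 run steps.
(* The analysis lets the rule vary with the iteration and the outcome; a single variant is a special
   case. *)
have step t w : exact_line_search f (x t w) (s t w) (gamma t w) \/
    (0 < Cf /\ short_step f Cf (x t w) (s t w) (gamma t w)).
  by case: steps => [ls|[C0 ss]]; [left|right].
split=> [|T].
  exact: (cvg_expectation_value oracleA cvxf difff finC xmin eta01 Mx0 run step).
rewrite (expectation_gap oracleA difff finC xmin Mx0 run step) lee_fin.
exact: (agap_le oracleA cvxf difff finC xmin eta01 Mx0 run step).
Qed.
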